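(* Let $n\ge 5$ and let $\Sigma$ be a bipyramid on $n$ vertices. Then every generic framework $(\Sigma,\mathbf p)$ in $\mathbb R^2$ admits at most $n-4$ congruence classes, i.e. the set of configurations $\mathbf q\in(\mathbb R^2)^n$ such that $(\Sigma,\mathbf q)$ is equivalent to $(\Sigma,\mathbf p)$ splits into at most $n-4$ classes under congruence.
   Context: For a configuration $\mathbf p=(\mathbf p(1),\dots,\mathbf p(n))\in(\mathbb R^2)^n$ and a triple $\sigma=i_1i_2i_3$ with $1\le i_1<i_2<i_3\le n$, let $C(\sigma,\mathbf p)$ be the $3\times 3$ matrix whose $k$-th column is $(1,\mathbf p(i_k))^T$. A framework $(\Sigma,\mathbf p)$ is a pure 2-dimensional simplicial complex $\Sigma$ on vertex set $\{1,\dots,n\}$ together with a configuration $\mathbf p\in(\mathbb R^2)^n$. Two frameworks $(\Sigma,\mathbf p)$, $(\Sigma,\mathbf q)$ are equivalent if $\det C(\sigma,\mathbf p)=\det C(\sigma,\mathbf q)$ for every 2-simplex $\sigma$ of $\Sigma$ (signed areas), and congruent if $\det C(\sigma,\mathbf p)=\det C(\sigma,\mathbf q)$ for every triple $\sigma\subseteq\{1,\dots,n\}$. The congruence classes of $(\Sigma,\mathbf p)$ are the equivalence classes, under congruence, of the set of configurations $\mathbf q$ with $(\Sigma,\mathbf q)$ equivalent to $(\Sigma,\mathbf p)$. A framework is generic if the $2n$ coordinates of $\mathbf p$ are algebraically independent over $\mathbb Q$. The bipyramid on $n$ vertices, $B_{n-2}$, is the pure 2-dimensional simplicial complex on $\{1,\dots,n\}$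 whose 2-simplices are $\{1,i,i+1\}$ and $\{i,i+1,n\}$ for $2\le i\le n-2$, together with $\{1,2,n-1\}$ and $\{2,n-1,n\}$. *)

(* Defs.v *)
From HB Require Import structures.
From mathcomp Require Import all_boot all_order all_algebra.
From mathcomp Require Import boolp classical_sets functions cardinality reals.
From mathcomp Require Import mpoly zify.

Set Implicit Arguments.
Unset Strict Implicit.
Unset Printing Implicit Defensive.

Import Order.TTheory GRing.Theory Num.Theory.
Local Open Scope ring_scope.

(* The vertex labelled v in {1, ..., n} is the ordinal of value v - 1. *)
Record pure2_complex (n : nat) := Pure2Complex {
  faces : {set {set 'I_n}};
  faces_down : forall s t : {set 'I_n},
    s \in faces -> t \subset s -> t \in faces;
  faces_vertex : forall v : 'I_n, [set v]%SET \in faces;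
  faces_pure : forall s : {set 'I_n}, s \in faces ->
    exists t : {set 'I_n}, [/\ t \in faces, s \subset t & #|t| = 3%N]
}.

Definition two_simplices (n : nat) (S : pure2_complex n) : {set {set 'I_n}} :=
  [set s in faces S | #|s| == 3%N]%SET.

Definition labelled (n : nat) (t : seq nat) : {set 'I_n} :=
  [set v : 'I_n | v.+1 \in t]%SET.

Definition bipyramid_triples (n : nat) : seq (seq nat) :=
  [seq [:: 1%N; i; i.+1] | i <- index_iota 2 n.-1]
  ++ [seq [:: i; i.+1; n] | i <- index_iota 2 n.-1]
  ++ [:: [:: 1%N; 2; n.-1]; [:: 2; n.-1; n]]%N.

Definition is_bipyramid (n : nat) (S : pure2_complex n) : Prop :=
  two_simplices S = [set:: [seq labelled n t | t <- bipyramid_triples n]]%SET.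

Lemma bipyramid_exists (n : nat) :
  (5 <= n)%N -> exists S : pure2_complex n, is_bipyramid S.
Proof.
move=> hn.
pose T := [set:: [seq labelled n t | t <- bipyramid_triples n]]%SET.
have lab3 a b c : (0 < a)%N -> (a < b)%N -> (b < c)%N -> (c <= n)%N ->
    #|labelled n [:: a; b; c]| = 3%N.
  move=> a0 ab bc cn.
  have ha : (a.-1 < n)%N by lia.
  have hb : (b.-1 < n)%N by lia.
  have hc : (c.-1 < n)%N by lia.
  have -> : labelled n [:: a; b; c]
      = [set Ordinal ha; Ordinal hb; Ordinal hc]%SET.
    by apply/setP => v; rewrite !inE -!val_eqE /=; lia.
  by rewrite -finset.setUA cardsU1 cards2 !inE -!val_eqE /=; lia.
have triples_mem (i : nat) : (2 <= i < n.-1)%N ->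
    labelled n [:: 1; i; i.+1]%N \in T /\ labelled n [:: i; i.+1; n] \in T.
  move=> hi; split; rewrite inE; apply: map_f; rewrite !mem_cat.
    by rewrite map_f // mem_index_iota.
  by rewrite orbC map_f // mem_index_iota.
have T3 t : t \in T -> #|t| = 3%N.
  rewrite inE => /mapP[u + ->]; rewrite !mem_cat => /or3P[/mapP[i]|/mapP[i]|].
  - by rewrite mem_index_iota => hi ->; apply: lab3; lia.
  - by rewrite mem_index_iota => hi ->; apply: lab3; lia.
  - by rewrite !inE => /orP[] /eqP ->; apply: lab3; lia.
have Tv (v : 'I_n) : exists2 t, t \in T & v \in t.
  have [v0|v0] := eqVneq (v : nat) 0%N.
    have [] := triples_mem 2%N; first by lia.
    by move=> h _; exists (labelled n [:: 1; 2; 3]%N) => //; rewrite !inE v0.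
  have [h|h] := leqP n.-2 v.
    exists (labelled n [:: 2; n.-1; n]%N).
      by rewrite inE; apply: map_f; rewrite !mem_cat !inE eqxx !orbT.
    by rewrite !inE; have := ltn_ord v; lia.
  have [] := triples_mem v.+1; first by lia.
  by move=> h' _; exists (labelled n [:: 1%N; v.+1; v.+2]) => //;
    rewrite !inE eqxx orbT.
pose F := [set s : {set 'I_n} | [exists t in T, s \subset t]]%SET.
have Fdown (s t : {set 'I_n}) : s \in F -> t \subset s -> t \in F.
  rewrite !inE => /exists_inP[u uT su] ts.
  by apply/exists_inP; exists u => //; apply: fintype.subset_trans su.
have Fv (v : 'I_n) : [set v]%SET \in F.
  by have [t tT vt] := Tv v; rewrite inE; apply/exists_inP; exists t;
    rewrite ?finset.sub1set.
have Fpure (s : {set 'I_n}) : s \in F ->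
    exists t : {set 'I_n}, [/\ t \in F, s \subset t & #|t| = 3%N].
  rewrite inE => /exists_inP[t tT st]; exists t; split => //; last exact: T3.
  by rewrite inE; apply/exists_inP; exists t.
exists (Pure2Complex Fdown Fv Fpure).
rewrite /is_bipyramid -/T; apply/setP => s; rewrite inE /=.
apply/andP/idP => [[]|sT]; last first.
  split; last by rewrite T3.
  by rewrite inE; apply/exists_inP; exists s.
rewrite inE => /exists_inP[t tT st] /eqP s3.
suff -> : s = t by [].
by apply/eqP; rewrite eqEcard st s3 T3.
Qed.

Section Frameworks.
Variables (R : realType) (n : nat).

(* Row i of a configuration is the point of the i-th vertex. *)
Definition configuration := 'M[R]_(n, 2).

Definition Cmat (i1 i2 i3 : 'I_n) (p : configuration) : 'M[R]_3 :=
  (\matrix_(k < 3) row_mx (1%:M : 'M_1) (row (tnth [tuple i1; i2; i3] k) p))^T.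

Definition equivalent (S : pure2_complex n) (p q : configuration) : Prop :=
  forall i1 i2 i3 : 'I_n, (i1 < i2 < i3)%N ->
    [set i1; i2; i3]%SET \in two_simplices S ->
    \det (Cmat i1 i2 i3 p) = \det (Cmat i1 i2 i3 q).

Definition congruent (p q : configuration) : Prop :=
  forall i1 i2 i3 : 'I_n, (i1 < i2 < i3)%N ->
    \det (Cmat i1 i2 i3 p) = \det (Cmat i1 i2 i3 q).

Definition congruence_classes (S : pure2_complex n) (p : configuration) :
    set (set configuration) :=
  [set [set q' | equivalent S p q' /\ congruent q q']
     | q in [set q | equivalent S p q]]%classic.

End Frameworks.

Definition alg_independent (R : realType) (m : nat) (x : 'I_m -> R) : Prop :=
  forall f : {mpoly rat[m]},
    (map_mpoly (@ratr R) f).@[x] = 0 -> f = 0.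

Definition generic (R : realType) (n : nat) (p : configuration R n) : Prop :=
  alg_independent (fun k : 'I_(n * 2) => mxvec p 0 k).

(* Main.v *)
Require Import Defs.
From mathcomp Require Import all_boot all_order all_algebra.
From mathcomp Require Import boolp classical_sets functions cardinality reals.
From mathcomp Require Import finmap mpoly zify ring.

Set Implicit Arguments.
Unset Strict Implicit.
Unset Printing Implicit Defensive.

Import GRing.Theory.

Local Open Scope ring_scope.

(** Write the equator as a cycle [v_0, ..., v_(m-1)] with [m = n - 2] and
    indices mod [m], let [o] and [w] be the apices ([bottom] and [top] below),
    [E i j] the signed area of [o i j], [a_j = E v_j v_(j+1)] and
    [h_j = E v_j w].  If [q] is equivalent to [p], the [a_j] and
    [c_j = h_0 - h_j] are the same for both, so that [h_j = t - c_j] with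
    [t = h_0] the only unknown.  The Pluecker relation gives
    [E v_0 v_(j+1) / h_(j+1) - E v_0 v_j / h_j = h_0 a_j / (h_j h_(j+1))], and
    summing around the equator yields [sum_j a_j / (h_j h_(j+1)) = 0].
    Clearing denominators, [t] is a root of a polynomial of degree at most
    [m - 2 = n - 4], whose coefficient of that degree is [sum_j a_j], nonzero
    by genericity.  Conversely [t] determines every [E i j], hence the
    congruence class.

    No [h_j] vanishes: the link of [v_j] is the quadrilateral
    [o v_(j-1) w v_(j+1)], and by the Pluecker relation based at [v_j] the
    product of the areas of the two triangles that [v_j] spans with its
    diagonals is the same for [q] as for [p]. *)

Section Area.
Variables (T : comPzRingType) (I : Type).
Implicit Types (g : I -> 'I_2 -> T) (i j k l o : I).

Definition area g i j k : T :=
  (g j 0 - g i 0) * (g k 1 - g i 1) - (g k 0 - g i 0) * (g j 1 - g i 1).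

Lemma area_swap g i j k : area g i k j = - area g i j k.
Proof. rewrite /area; ring. Qed.

Lemma area_rot g i j k : area g j k i = area g i j k.
Proof. rewrite /area; ring. Qed.

Lemma area_repeat g i j :
  (area g i i j = 0) * (area g i j i = 0) * (area g i j j = 0).
Proof. by rewrite /area; do !split; ring. Qed.

Lemma area_cocycle g o i j k :
  area g i j k = area g o i j + area g o j k - area g o i k.
Proof. rewrite /area; ring. Qed.

Lemma area_plucker g o i j k l :
  area g o i k * area g o j l =
  area g o i j * area g o k l + area g o i l * area g o j k.
Proof. rewrite /area; ring. Qed.

End Area.

Lemma rmorph_area (T U : comPzRingType) (f : {rmorphism T -> U}) (I : Type)
    (g : I -> 'I_2 -> T) i j k :
  f (area g i j k) = area (fun l c => f (g l c)) i j k.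
Proof. by rewrite /area !(rmorphB, rmorphM). Qed.

Lemma area_delta_mx (T : comPzRingType) n (o i j k l : 'I_n) :
  o != i -> o != j ->
  area (delta_mx i 0 + delta_mx j 1 : 'M[T]_(n, 2)) o k l =
  ((k == i) && (l == j))%:R - ((l == i) && (k == j))%:R.
Proof.
move=> /negPf oi /negPf oj.
by rewrite /area !mxE oi oj !andbT !andbF !addr0 !add0r !subr0 -!natrM !mulnb.
Qed.

Lemma area_ext (T : idomainType) (I : Type) (g h : I -> 'I_2 -> T) (o u w : I) :
  area g o u w != 0 ->
  (forall i, area g o u i = area h o u i) ->
  (forall i, area g o i w = area h o i w) ->
  forall i j k, area g i j k = area h i j k.
Proof.
move=> + gu gw i j k; rewrite gu => huw0.
suff go a b : area g o a b = area h o a b by rewrite !(area_cocycle _ o i) !go.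
have := area_plucker g o u a b w; rewrite !gu !gw (area_plucker h).
by move=> /addrI /(mulfI huw0).
Qed.

Lemma area_fan (F : fieldType) (I : Type) (g : I -> 'I_2 -> F) (o w : I)
    (v : nat -> I) (k : nat) :
  (forall j, area g o (v j) w != 0) ->
  area g o (v 0) (v k) =
  area g o (v 0) w * area g o (v k) w *
  \sum_(j < k) area g o (v j) (v j.+1)
               / (area g o (v j) w * area g o (v j.+1) w).
Proof.
move=> gow_neq0; elim: k => [|k IHk].
  by rewrite big_ord0 area_repeat mulr0.
apply: (mulIf (gow_neq0 k)); rewrite big_ord_recr /=.
rewrite (area_plucker _ _ _ (v k)) IHk; field.
by rewrite !gow_neq0.
Qed.

Lemma set3_rot (T : finType) (x y z : T) :
  [set y; z; x]%SET = [set x; y; z]%SET.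
Proof. by rewrite finset.setUC finset.setUA. Qed.

Lemma eq_area_sorted (T : comPzRingType) n (g h : 'I_n -> 'I_2 -> T)
    (P : {set 'I_n} -> Prop) :
  (forall i j k : 'I_n, (i < j < k)%N -> P [set i; j; k]%SET ->
    area g i j k = area h i j k) ->
  forall i j k : 'I_n, P [set i; j; k]%SET -> area g i j k = area h i j k.
Proof.
move=> gh_lt.
pose gh (i j k : 'I_n) := P [set i; j; k]%SET -> area g i j k = area h i j k.
have gh_swap i j k : gh i k j -> gh i j k.
  by move=> ghikj ijk; rewrite area_swap [RHS]area_swap ghikj // finset.setUAC.
have gh_rot i j k : gh j k i -> gh i j k.
  by move=> ghjki ijk; rewrite -area_rot -[RHS]area_rot ghjki // set3_rot.
have gh_le (i j k : 'I_n) : (i <= j)%N -> (j <= k)%N -> gh i j k.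
  rewrite leq_eqVlt => /predU1P[/val_inj-> _ _|ij].
    by rewrite !area_repeat.
  rewrite leq_eqVlt => /predU1P[/val_inj-> _|jk]; first by rewrite !area_repeat.
  by apply: gh_lt; rewrite ij.
move=> i j k; rewrite -/(gh i j k).
have [ij|/ltnW ji] := leqP i j; have [jk|/ltnW kj] := leqP j k.
- exact: gh_le.
- have [ik|/ltnW ki] := leqP i k; first by apply/gh_swap/gh_le.
  by apply/gh_rot/gh_rot/gh_le.
- have [ik|/ltnW ki] := leqP i k; first by apply/gh_rot/gh_swap/gh_le.
  by apply/gh_rot/gh_le.
- by apply/gh_swap/gh_rot/gh_le.
Qed.

Lemma det_mx33 (T : comPzRingType) (A : 'M[T]_3) :
  \det A = A 0 0 * (A 1 1 * A 2 2 - A 1 2 * A 2 1)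
         - A 0 1 * (A 1 0 * A 2 2 - A 1 2 * A 2 0)
         + A 0 2 * (A 1 0 * A 2 1 - A 1 1 * A 2 0).
Proof.
(* Indexing by [nat] lets the ordinals produced by the expansions compute. *)
pose B (i j : nat) := A (inord i) (inord j).
have -> : A = \matrix_(i, j) B i j.
  by apply/matrixP => i j; rewrite !mxE /B !inord_val.
rewrite (expand_det_row _ 0) !big_ord_recl big_ord0 /cofactor.
rewrite !(expand_det_row _ 0) !big_ord_recl !big_ord0 /cofactor !det_mx11 !mxE.
by rewrite /= /bump /=; ring.
Qed.

Section Frameworks.
Variables (R : realType) (n : nat).
Implicit Types (S : pure2_complex n) (p q : configuration R n).
Implicit Types (i j k l m : 'I_n).

Lemma det_Cmat p i j k : \det (Cmat i j k p) = area p i j k.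
Proof.
have C0 (l : 'I_3) : Cmat i j k p 0 l = 1.
  by rewrite 2!mxE -(lshift0 2 0) row_mxEl mxE.
have CS c (l : 'I_3) : Cmat i j k p (lift 0 c) l = p (tnth [tuple i; j; k] l) c.
  by rewrite 2!mxE -rshift1 row_mxEr mxE.
rewrite det_mx33 !C0.
have -> : 2 = lift 0 1 :> 'I_3 by apply: val_inj.
have -> : 1 = lift 0 0 :> 'I_3 by apply: val_inj.
rewrite !CS /area !(tnth_nth i) /=; ring.
Qed.

Lemma congruent_areaP p q :
  congruent p q <-> forall i j k, area p i j k = area q i j k.
Proof.
split=> [pq i j k|pq i j k _]; last by rewrite !det_Cmat.
apply: (@eq_area_sorted _ _ p q (fun=> True)) => // {}i {}j {}k /pq.
by rewrite !det_Cmat.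
Qed.

Lemma equivalent_area S p q i j k : equivalent S p q ->
  [set i; j; k]%SET \in two_simplices S -> area p i j k = area q i j k.
Proof.
move=> pq; apply: (@eq_area_sorted _ _ p q (fun s => s \in two_simplices S)).
by move=> {}i {}j {}k ijk /(pq _ _ _ ijk); rewrite !det_Cmat.
Qed.

Lemma equivalent_quad_link S p q i j k l m : equivalent S p q ->
  [set i; j; k]%SET \in two_simplices S ->
  [set i; k; l]%SET \in two_simplices S ->
  [set i; l; m]%SET \in two_simplices S ->
  [set i; j; m]%SET \in two_simplices S ->
  area p i j l * area p i k m = area q i j l * area q i k m.
Proof.
move=> pq ijk ikl ilm ijm.
by rewrite (area_plucker p) (area_plucker q) !(equivalent_area pq).
Qed.

End Frameworks.

Lemma alg_independent_meval_neq0 (R : realType) m (x : 'I_m -> R)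
    (f : {mpoly rat[m]}) (y : 'I_m -> rat) :
  alg_independent x -> f.@[y] != 0 -> (map_mpoly (@ratr R) f).@[x] != 0.
Proof. by move=> x_indep; apply: contraNneq => /x_indep ->; rewrite meval0. Qed.

Section GenericAreas.
Variables (R : realType) (n : nat) (p : configuration R n).
Hypothesis p_generic : generic p.

Lemma generic_sum_area_neq0 (J : finType) (u v w : J -> 'I_n)
    (M : 'M[rat]_(n, 2)) :
  \sum_x area M (u x) (v x) (w x) != 0 ->
  \sum_x area p (u x) (v x) (w x) != 0.
Proof.
pose g (i : 'I_n) (c : 'I_2) : {mpoly rat[n * 2]} := 'X_(mxvec_index i c).
pose f := \sum_x area g (u x) (v x) (w x).
have rmorph_f (T : comPzRingType) (h : {rmorphism {mpoly rat[n * 2]} -> T})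
    (q : 'M[T]_(n, 2)) : (forall i c, h (g i c) = q i c) ->
    h f = \sum_x area q (u x) (v x) (w x).
  move=> hg; rewrite rmorph_sum; apply: eq_bigr => x _.
  by rewrite rmorph_area /area !hg.
have <- : f.@[mxvec M 0] = \sum_x area M (u x) (v x) (w x).
  apply: (rmorph_f _ (meval (mxvec M 0))) => i c.
  exact: etrans (mevalXU _ _) (mxvecE _ _ _).
have <- : (map_mpoly (@ratr R) f).@[mxvec p 0]
    = \sum_x area p (u x) (v x) (w x).
  apply: (rmorph_f _ (meval (mxvec p 0) \o map_mpoly (@ratr R))) => i c /=.
  by rewrite map_mpolyX mevalXU mxvecE.
exact: alg_independent_meval_neq0.
Qed.

Lemma generic_area_neq0 i j k :
  i != j -> i != k -> j != k -> area p i j k != 0.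
Proof.
move=> ij ik jk.
have := @generic_sum_area_neq0 unit (fun=> i) (fun=> j) (fun=> k)
  (delta_mx j 0 + delta_mx k 1).
rewrite !big_const !card_unit /= !addr0; apply.
by rewrite area_delta_mx // !eqxx (eq_sym k) (negPf jk) subr0 oner_neq0.
Qed.

End GenericAreas.

Section PartialFractions.
Variables (F : fieldType) (I J : finType).
Variables (A : J -> {set I}) (a : J -> F) (c : I -> F).

(* The numerator of [\sum_j a j / \prod_(i in A j) ('X - c i)] over the common
   denominator [\prod_i ('X - c i)]. *)
Definition pfrac_num : {poly F} :=
  \sum_j a j *: \prod_(i in ~: A j) ('X - (c i)%:P).

Lemma horner_pfrac_num t : (forall i, t - c i != 0) ->
  pfrac_num.[t] =
  (\prod_i (t - c i)) * \sum_j a j / \prod_(i in A j) (t - c i).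
Proof.
move=> tc; rewrite horner_sum mulr_sumr; apply: eq_bigr => j _.
rewrite hornerZ horner_prod [in RHS](bigID (mem (A j))) /=.
under eq_bigr do rewrite hornerXsubC.
rewrite (eq_bigl (fun i => i \notin A j)) => [|i]; last by rewrite inE.
have : \prod_(i in A j) (t - c i) != 0 by apply/prodf_neq0.
by move: (\prod_(i in A j) _) (\prod_(i | i \notin A j) _) => x y x0; field.
Qed.

Variable d : nat.
Hypothesis card_A : forall j, #|A j| = d.

Lemma size_pfrac_term j :
  size (\prod_(i in ~: A j) ('X - (c i)%:P)) = (#|I| - d).+1.
Proof.
by rewrite -big_enum size_prod_XsubC -cardE cardsCs finset.setCK card_A.
Qed.

Lemma size_pfrac_num : (size pfrac_num <= (#|I| - d).+1)%N.
Proof.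
apply: (leq_trans (size_sum _ _ _)); apply/bigmax_leqP => j _.
by rewrite (leq_trans (size_scale_leq _ _)) // size_pfrac_term.
Qed.

Lemma coef_pfrac_num : pfrac_num`_(#|I| - d) = \sum_j a j.
Proof.
rewrite coef_sum; apply: eq_bigr => j _.
have /monicP : \prod_(i in ~: A j) ('X - (c i)%:P) \is monic.
  exact: monic_prod_XsubC.
by rewrite lead_coefE size_pfrac_term coefZ => ->; rewrite mulr1.
Qed.

End PartialFractions.

Section Cardinality.
Local Open Scope classical_set_scope.
Local Open Scope card_scope.

Lemma card_le_II_uniq (T : choiceType) (A : set T) (k : nat) :
  (forall s : seq T, uniq s -> {in s, forall x, A x} -> (size s <= k)%N) ->
  A #<= `I_k.
Proof.
move=> sA; have [/finite_fsetP [X AX]|A_infinite] := pselect (finite_set A).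
  have /card_eq_fsetP/card_le_eql cardX : #|` X|%fset = #|` X|%fset by [].
  by rewrite AX cardX card_le_II sA // => x xX; rewrite AX.
have [X XA] := infinite_set_fset k.+1 A_infinite; rewrite ltnNge.
by rewrite sA // => x; apply: XA.
Qed.

Lemma card_root_le (F : idomainType) (P : {poly F}) :
  P != 0 -> [set x | root P x] #<= `I_(size P).-1.
Proof.
move=> P0; apply: card_le_II_uniq => s s_uniq sP.
rewrite -ltnS prednK ?size_poly_gt0 //.
by apply: max_poly_roots => //; apply/allP => x /sP.
Qed.

Lemma card_classes_le (T U : Type) (A : set T) (r : T -> T -> Prop)
    (f : T -> U) :
  (forall x y, A x -> A y -> r x y <-> f x = f y) ->
  [set [set y | A y /\ r x y] | x in A] #<= f @` A.
Proof.
move=> rf; pose fiber t := [set y | A y /\ t = f y].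
have -> : [set [set y | A y /\ r x y] | x in A] = fiber @` (f @` A).
  rewrite image_comp; apply: eq_imagel => x Ax.
  apply/seteqP.
  by split=> y [Ay /(rf x y Ax Ay) xy]; split=> //; apply/(rf x y).
exact: card_image_le.
Qed.

End Cardinality.

Lemma labelled3 n (i j k : 'I_n) :
  labelled n [:: i.+1; j.+1; k.+1] = [set i; j; k]%SET.
Proof. by apply/setP => v; rewrite !inE !eqSS !val_eqE orbA. Qed.

Lemma ordS_neq m (j : 'I_m) : (1 < m)%N -> ordS j != j.
Proof.
move=> m_gt1; rewrite -val_eqE /= -[X in _ != X](modn_small (ltn_ord j)).
by rewrite -addn1 -[X in _ != X %[mod _]]addn0 eqn_modDl !modn_small // ltnW.
Qed.

Section Bipyramid.
Variables (R : realType) (m : nat).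
Hypothesis m_gt2 : (2 < m)%N.
Local Notation n := m.+2.
Local Notation bottom := (@ord0 m.+1).
Local Notation top := (@ord_max m.+1).

Let m_gt0 : (0 < m)%N. Proof. exact: ltn_trans m_gt2. Qed.

Definition equator (j : nat) : 'I_n := inord (j %% m).+1.

Lemma equator_val j : equator j = (j %% m).+1 :> nat.
Proof. by rewrite inordK // !ltnS ltnW // ltn_pmod. Qed.

Lemma eq_equator i j : (equator i == equator j) = (i == j %[mod m]).
Proof. by rewrite -val_eqE /= !equator_val. Qed.

Lemma equator_mod j : equator (j %% m) = equator j.
Proof. by apply/eqP; rewrite eq_equator modn_mod. Qed.

Lemma equatorS_mod j : equator (j %% m).+1 = equator j.+1.
Proof. by apply/eqP; rewrite eq_equator -addn1 modnDml addn1. Qed.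

Lemma equatorD j : equator (j + m) = equator j.
Proof. by apply/eqP; rewrite eq_equator modnDr. Qed.

Lemma bottom_neq_equator j : bottom != equator j.
Proof. by rewrite -val_eqE /= equator_val. Qed.

Lemma equator_neq_top j : equator j != top.
Proof. by rewrite -val_eqE /= equator_val eqSS ltn_eqF // ltn_pmod. Qed.

Lemma equator_consecutive_neq j :
  [/\ equator j != equator j.+1, equator j != equator j.+2
    & equator j.+1 != equator j.+2].
Proof.
have shift_neq k l : (k < m)%N -> (l < m)%N -> k != l ->
    equator (k + j) != equator (l + j).
  by move=> km lm; rewrite eq_equator eqn_modDr !modn_small.
by split;
  [apply: (shift_neq 0 1)|apply: (shift_neq 0 2)|apply: (shift_neq 1 2)]; lia.
Qed.

Lemma bipyramid_vertexP (i : 'I_n) :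
  [\/ i = bottom, i = top | exists j, i = equator j].
Proof.
have [->|i0] := eqVneq i bottom; first by constructor 1.
have [->|im] := eqVneq i top; first by constructor 2.
constructor 3; exists i.-1; apply: val_inj; rewrite /= equator_val.
move: i0 im (ltn_ord i); rewrite -!val_eqE /= => i0 im i_lt.
by rewrite modn_small; lia.
Qed.

Definition lower_area (q : configuration R n) j : R :=
  area q bottom (equator j) (equator j.+1).

Definition upper_area (q : configuration R n) j : R :=
  area q top (equator j) (equator j.+1).

Definition height (q : configuration R n) j : R :=
  area q bottom (equator j) top.

Definition height_drop (q : configuration R n) j : R := height q 0 - height q j.

Lemma height_dropS q j :
  height_drop q j.+1 = height_drop q j + lower_area q j - upper_area q j.
Proof.
rewrite /height_drop /upper_area -area_rot (area_cocycle _ bottom).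
rewrite -/(lower_area q j) -!/(height q _); ring.
Qed.

Lemma congruent_height p q j : congruent p q -> height p j = height q j.
Proof. by move/congruent_areaP; apply. Qed.

Section Equivalence.
Variables (S : pure2_complex n).
Hypothesis bipyramid_S : is_bipyramid S.

Lemma equator_faces j :
  [set bottom; equator j; equator j.+1]%SET \in two_simplices S /\
  [set top; equator j; equator j.+1]%SET \in two_simplices S.
Proof.
rewrite -(equator_mod j) -equatorS_mod bipyramid_S !inE.
have : (j %% m < m)%N by rewrite ltn_pmod.
move: (j %% m)%N => {}j; rewrite leq_eqVlt => /predU1P[jm|jm].
  have vj1 : equator j.+1 = 1%N :> nat by rewrite equator_val jm modnn.
  have vj : equator j = m :> nat by rewrite equator_val modn_small; lia.
  rewrite [in X in X /\ _]finset.setUAC [in X in _ /\ X]finset.setUAC.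
  rewrite -(set3_rot top) -!labelled3 vj1 vj !map_f //.
    by rewrite !mem_cat !inE eqxx !orbT.
  by rewrite !mem_cat !inE eqxx !orbT.
have vj1 : equator j.+1 = j.+2 :> nat by rewrite equator_val modn_small.
have vj : equator j = j.+1 :> nat by rewrite equator_val modn_small; lia.
rewrite -(set3_rot top) -!labelled3 vj1 vj !map_f // !mem_cat.
  by rewrite (map_f (fun i => [:: i; i.+1; n])) ?orbT // mem_index_iota.
by rewrite (map_f (fun i => [:: 1%N; i; i.+1])) // mem_index_iota.
Qed.

Lemma equivalent_lower_area p q j :
  equivalent S p q -> lower_area p j = lower_area q j.
Proof. by move/equivalent_area; apply; have [] := equator_faces j. Qed.

Lemma equivalent_upper_area p q j :
  equivalent S p q -> upper_area p j = upper_area q j.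
Proof. by move/equivalent_area; apply; have [] := equator_faces j. Qed.

Lemma equivalent_height_drop p q j :
  equivalent S p q -> height_drop p j = height_drop q j.
Proof.
move=> pq; elim: j => [|j IHj]; first by rewrite /height_drop !subrr.
rewrite !height_dropS IHj.
by rewrite (equivalent_lower_area _ pq) (equivalent_upper_area _ pq).
Qed.

Lemma equivalent_heightE p q j :
  equivalent S p q -> height q j = height q 0 - height_drop p j.
Proof. by move=> pq; rewrite (equivalent_height_drop _ pq) subKr. Qed.

Section Generic.
Variable p : configuration R n.
Hypothesis p_generic : generic p.

Lemma equivalent_height_neq0 q j : equivalent S p q -> height q j != 0.
Proof.
have -> : height q j = height q (j + m.-1).+1.
  by rewrite /height -addnS prednK // equatorD.
move: (j + m.-1)%N => {}j pq.
have [v01 v02 v12] := equator_consecutive_neq j.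
have [bottom01 top01] := equator_faces j.
have [bottom12 top12] := equator_faces j.+1.
have : area p (equator j.+1) bottom top
       * area p (equator j.+1) (equator j) (equator j.+2) != 0.
  rewrite mulf_neq0 // generic_area_neq0 ?equator_neq_top //.
    by rewrite eq_sym bottom_neq_equator.
  by rewrite eq_sym.
rewrite (equivalent_quad_link pq) ?mulf_eq0 ?negb_or => [/andP[h0 _]| | | |].
- by rewrite /height area_swap area_rot oppr_eq0.
- by rewrite 2!set3_rot.
- by rewrite set3_rot finset.setUAC.
- by rewrite finset.setUAC set3_rot.
- by rewrite finset.setUAC set3_rot.
Qed.

Lemma sum_lower_area_neq0 : \sum_(j < m) lower_area p j != 0.
Proof.
have [v01 v02 _] := equator_consecutive_neq 0.
apply: (@generic_sum_area_neq0 _ _ _ p_generic 'I_m (fun=> bottom)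
  (fun j => equator j) (fun j => equator j.+1)
  (delta_mx (equator 0) 0 + delta_mx (equator 1) 1)).
under eq_bigr do rewrite area_delta_mx ?bottom_neq_equator //.
rewrite (bigD1 (Ordinal m_gt0)) //= big1 => [|j].
  by rewrite !eqxx (eq_sym _ (equator 0)) (negPf v01) subr0 addr0 oner_neq0.
rewrite -val_eqE /= => /negPf j0.
rewrite (eq_equator j 0) (modn_small (ltn_ord j)) mod0n j0 /= sub0r.
have [j1|//] := eqVneq (equator j) (equator 1); last by rewrite andbF oppr0.
have -> : equator j.+1 = equator 2.
  by apply/eqP; move/eqP: j1; rewrite !eq_equator -(eqn_modDr 1) !addn1.
by rewrite eq_sym (negPf v02) oppr0.
Qed.

Definition height_poly : {poly R} :=
  pfrac_num (fun j : 'I_m => [set j; ordS j]%SET) (lower_area p)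
    (height_drop p).

Let card_rim_edge (j : 'I_m) : #|[set j; ordS j]%SET| = 2.
Proof. by rewrite cards2 eq_sym ordS_neq // ltnW. Qed.

Lemma size_height_poly : (size height_poly <= m.-1)%N.
Proof.
rewrite (leq_trans (size_pfrac_num _ _ card_rim_edge)) // card_ord.
by lia.
Qed.

Lemma height_poly_neq0 : height_poly != 0.
Proof.
apply: contraNneq sum_lower_area_neq0 => height_poly0.
rewrite -(coef_pfrac_num (fun j : 'I_m => lower_area p j)
  (fun j : 'I_m => height_drop p j) card_rim_edge).
by rewrite -/height_poly height_poly0 coef0.
Qed.

Lemma root_height_poly q : equivalent S p q -> root height_poly (height q 0).
Proof.
move=> pq; have h_neq0 j := equivalent_height_neq0 j pq.
rewrite /root horner_pfrac_num => [|j]; last by rewrite -equivalent_heightE.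
have : area q bottom (equator 0) (equator m) = 0.
  by rewrite (equatorD 0) area_repeat.
rewrite (area_fan _ h_neq0) => /eqP; rewrite !mulf_eq0 !(negPf (h_neq0 _)) /=.
move=> /eqP fan0; apply/orP; right; apply/eqP; rewrite -[RHS]fan0.
apply: eq_bigr => j _.
have j_notin : j \notin [set ordS j]%SET by rewrite inE eq_sym ordS_neq // ltnW.
rewrite big_setU1 //= big_set1 -!equivalent_heightE //.
by rewrite (equivalent_lower_area _ pq) [height q (ordS j)]/height equator_mod.
Qed.

Lemma congruent_of_height q q' : equivalent S p q -> equivalent S p q' ->
  height q 0 = height q' 0 -> congruent q q'.
Proof.
move=> pq pq' h0; apply/congruent_areaP.
have h_neq0 j := equivalent_height_neq0 j pq.
have h'_neq0 j := equivalent_height_neq0 j pq'.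
have heightE j : height q j = height q' j.
  by rewrite (equivalent_heightE _ pq) (equivalent_heightE _ pq') h0.
apply: (@area_ext _ _ q q' bottom (equator 0) top); first exact: h_neq0.
- move=> i; case: (bipyramid_vertexP i) => [->|->|[j ->]].
  + by rewrite !area_repeat.
  + exact: heightE.
  rewrite (area_fan _ h_neq0) (area_fan _ h'_neq0) -!/(height _ _) !heightE.
  congr (_ * _); apply: eq_bigr => k _.
  rewrite -!/(height _ _) !heightE -!/(lower_area _ _).
  by rewrite -(equivalent_lower_area _ pq) (equivalent_lower_area _ pq').
- move=> i; case: (bipyramid_vertexP i) => [->|->|[j ->]].
  + by rewrite !area_repeat.
  + by rewrite !area_repeat.
  + exact: heightE.
Qed.

End Generic.
End Equivalence.
End Bipyramid.

Local Open Scope classical_set_scope.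
Local Open Scope card_scope.

Theorem theorem1p2 (R : realType) (n : nat) (hn : (5 <= n)%N)
  (S : pure2_complex n) (hS : is_bipyramid S)
  (p : configuration R n) (hp : generic p) :
  congruence_classes S p #<= `I_(n - 4)%N.
Proof.
case: n hn S hS p hp => [|[|m]] // m_gt2 S hS p hp.
have heightP q q' : equivalent S p q -> equivalent S p q' ->
    congruent q q' <-> height q 0 = height q' 0.
  move=> pq pq'; split; first exact: congruent_height.
  exact: (congruent_of_height m_gt2 hS hp).
have height_root : [set height q 0 | q in [set q | equivalent S p q]]
    `<=` [set t | root (height_poly p) t].
  by move=> _ [q pq <-]; apply: root_height_poly pq.
apply: (card_le_trans (card_classes_le heightP)).
apply: (card_le_trans (subset_card_le height_root)).
apply: (card_le_trans (card_root_le (height_poly_neq0 m_gt2 hp))).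
rewrite card_le_II; move: (size_height_poly m_gt2 p).
by case: (size _) => [|d]; lia.
Qed.
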